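(* For every integer $n\geq 2$, the group Zariski topology on the Thompson group $V_n$ is irreducible (in the case $n=2$, $V_2=V$ is Thompson's group $V$). Also, the group Zariski topology on $\operatorname{Homeo}(2^\omega)$, the group of all homeomorphisms of the Cantor space $2^\omega=\{0,1\}^\omega$, is irreducible. In particular, each of these topologies is neither Hausdorff nor a group topology.
   Context: A group topology on a group $G$ is a topology on the set $G$ for which multiplication $G\times G\to G$ and inversion $G\to G$ are continuous. The group Zariski topology $\mathfrak{Z}_G$ on a group $G$ with identity $1_G$ is the topology on $G$ with subbasis consisting of the sets $\{x\in G \mid 1_G\neq g_0x^{k_0}g_1\cdots g_{l-1}x^{k_{l-1}}g_l\}$, where $l\in\mathbb{N}=\{0,1,2,\ldots\}$, $g_0,\ldots,g_l\in G$ and $k_0,\ldots,k_{l-1}\in\mathbb{Z}$. A topological space $X$ is irreducible if $K_1\cup K_2\neq X$ whenever $K_1,K_2\subsetneq X$ are closed; equivalently, every non-empty open subset of $X$ is dense. The Thompson group $V_n$ is the group of those homeomorphisms $f$ of the Cantor space $\{0,1,\ldots,n-1\}^\omega$ (product of discrete spaces) that are piecewise given by prefix replacements: for every $x=x_0x_1x_2\ldots\in\{0,\ldots,n-1\}^\omega$ there are $i,j\in\mathbb{N}$ and a finite word $y_0y_1\ldots y_j$ over $\{0,\ldots,n-1\}$ such that $f(x_0x_1\ldots x_iz_0z_1\ldots)=y_0y_1\ldots y_jz_0z_1\ldots$ for all $z_0z_1\ldots\in\{0,\ldots,n-1\}^\omega$. *)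

(* Defs.v *)
From HB Require Import structures.
From mathcomp Require Import all_boot all_algebra.
From mathcomp Require Import all_classical topology cantor.

Set Implicit Arguments.
Unset Strict Implicit.
Unset Printing Implicit Defensive.

Local Open Scope classical_set_scope.
Local Open Scope group_scope.

Definition irreducible_space (X : topologicalType) : Prop :=
  forall K1 K2 : set X, closed K1 -> closed K2 ->
    K1 `<` setT -> K2 `<` setT -> K1 `|` K2 <> setT.

(* A group together with a topology, with no compatibility condition. *)
#[short(type="groupWithTopologyType")]
HB.structure Definition GroupWithTopology := {G of Group G & Topological G}.

Definition is_group_topology (G : groupWithTopologyType) : Prop :=
  continuous (fun p : G * G => p.1 * p.2) /\ continuous (fun x : G => x^-1).

Definition expgz (G : groupType) (x : G) (k : int) : G :=
  match k with
  | Posz m => x ^+ m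
  | Negz m => x ^- m.+1
  end.

(* g 0 * x ^ (k 0) * g 1 * ... * g (l - 1) * x ^ (k (l - 1)) * g l; only the
   values g 0, ..., g l and k 0, ..., k (l - 1) matter. *)
Definition word_value (G : groupType) (l : nat) (g : nat -> G) (k : nat -> int)
    (x : G) : G :=
  g 0%N * \prod_(i < l) (expgz x (k i) * g i.+1).

Definition zariski_subbasis (G : groupType) : set (set G) :=
  [set U | exists (l : nat) (g : nat -> G) (k : nat -> int),
     U = [set x | 1 <> word_value l g k x]].

(* Alias of G carrying the group Zariski topology. *)
Definition zariski (G : groupType) : Type := G.

HB.instance Definition _ (G : groupType) := Group.on (zariski G).
HB.instance Definition _ (G : groupType) :=
  isSubBaseTopological.Build (zariski G) (@zariski_subbasis G) id.

(* The inverse is recorded as data so that the group operations are explicit;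
   it is determined by the underlying function (see homeo_inj). *)
Record homeo (X : topologicalType) : Type := Homeo {
  homeo_fun :> X -> X;
  homeo_inv : X -> X;
  homeo_funK : cancel homeo_fun homeo_inv;
  homeo_invK : cancel homeo_inv homeo_fun;
  homeo_fun_continuous : continuous homeo_fun;
  homeo_inv_continuous : continuous homeo_inv
}.

Section HomeoGroup.
Context (X : topologicalType).
Implicit Types f g h : homeo X.

Lemma homeo_inj f g : homeo_fun f = homeo_fun g -> f = g.
Proof.
case: f g => [f f' fK f'K cf cf'] [g g' gK g'K cg cg'] /= fg; subst g.
have f'g' : f' = g' by apply/funext => y; rewrite -[y in LHS]g'K fK.
subst g'; congr Homeo; exact: Prop_irrelevance.
Qed.

Lemma homeo_continuous_comp (u v : X -> X) :
  continuous u -> continuous v -> continuous (u \o v).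
Proof. by move=> cu cv x; apply: continuous_comp; [exact: cv | exact: cu]. Qed.

Lemma homeo_continuous_id : continuous (@id X).
Proof. by move=> x; exact: cvg_id. Qed.

Definition homeo_one : homeo X :=
  @Homeo X id id (fun=> erefl) (fun=> erefl)
    homeo_continuous_id homeo_continuous_id.

Definition homeo_mul f g : homeo X :=
  Homeo (can_comp (homeo_funK f) (homeo_funK g))
        (can_comp (homeo_invK g) (homeo_invK f))
        (homeo_continuous_comp (@homeo_fun_continuous _ f)
                               (@homeo_fun_continuous _ g))
        (homeo_continuous_comp (@homeo_inv_continuous _ g)
                               (@homeo_inv_continuous _ f)).

Definition homeo_invg f : homeo X :=
  Homeo (homeo_invK f) (homeo_funK f)
        (@homeo_inv_continuous _ f) (@homeo_fun_continuous _ f).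

Lemma homeo_mulA : associative homeo_mul.
Proof. by move=> f g h; exact: homeo_inj. Qed.

Lemma homeo_mul1 : left_id homeo_one homeo_mul.
Proof. by move=> f; exact: homeo_inj. Qed.

Lemma homeo_mulr1 : right_id homeo_one homeo_mul.
Proof. by move=> f; exact: homeo_inj. Qed.

Lemma homeo_mulV : left_inverse homeo_one homeo_invg homeo_mul.
Proof. by move=> f; apply/homeo_inj/funext => x /=; exact: homeo_funK. Qed.

Lemma homeo_mulrV : right_inverse homeo_one homeo_invg homeo_mul.
Proof. by move=> f; apply/homeo_inj/funext => x /=; exact: homeo_invK. Qed.

HB.instance Definition _ := gen_eqMixin (homeo X).
HB.instance Definition _ := gen_choiceMixin (homeo X).
HB.instance Definition _ := isGroup.Build (homeo X)
  homeo_mulA homeo_mul1 homeo_mulr1 homeo_mulV homeo_mulrV.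

Lemma homeo_mulE f g (x : X) : (f * g) x = f (g x).
Proof. by []. Qed.

End HomeoGroup.

(* {0, ..., n - 1}^omega with the product of the discrete topologies. *)
Definition omega_words (n : nat) : topologicalType :=
  prod_topology (fun _ : nat => discrete_topology 'I_n).

(* The infinite word consisting of the finite word s followed by z. *)
Definition prepend (A : Type) (s : seq A) (z : nat -> A) : nat -> A :=
  fun k => nth (z (k - size s)%N) s k.

(* mkseq x i.+1 is the prefix x_0 ... x_i of x. *)
Definition prefix_replacing (n : nat) (f : omega_words n -> omega_words n) :
    Prop :=
  forall x : omega_words n,
    exists (i j : nat) (y : j.+1.-tuple 'I_n),
      forall z : omega_words n, f (prepend (mkseq x i.+1) z) = prepend y z.

Definition thompsonV_pred (n : nat) : {pred homeo (omega_words n)} :=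
  fun f => `[< prefix_replacing f >].

Section PrependTheory.
Context (A : Type).
Implicit Types (s t : seq A) (x z : nat -> A).

Lemma prepend_cat s t z : prepend (s ++ t) z = prepend s (prepend t z).
Proof.
apply/funext => k; rewrite /prepend nth_cat size_cat subnDA.
case: ltnP => ks; first by apply: set_nth_default.
by rewrite [RHS]nth_default.
Qed.

Lemma prepend_prefix x (m : nat) :
  prepend (mkseq x m) (fun k => x (m + k)%N) = x.
Proof.
apply/funext => k; rewrite /prepend size_mkseq.
case: (ltnP k m) => km; first by rewrite nth_mkseq.
by rewrite nth_default ?size_mkseq // subnKC.
Qed.

Lemma mkseq_prepend s z (m : nat) :
  mkseq (prepend s z) (size s + m) = s ++ mkseq z m.
Proof.
apply: (@eq_from_nth _ (z 0%N)); first by rewrite size_cat !size_mkseq.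
move=> k; rewrite size_mkseq => km; rewrite nth_mkseq // nth_cat /prepend.
case: ltnP => ks; first by apply: set_nth_default.
by rewrite nth_default // nth_mkseq // ltn_subLR.
Qed.

Lemma mkseq_add x (a b : nat) :
  mkseq x (a + b) = mkseq x a ++ mkseq (fun k => x (a + k)%N) b.
Proof.
by have := mkseq_prepend (mkseq x a) (fun k => x (a + k)%N) b;
  rewrite prepend_prefix size_mkseq.
Qed.

End PrependTheory.

Section ThompsonGroup.
Context (n : nat).
Implicit Types (f g : homeo (omega_words n)).

Lemma prefix_replacingI (u : omega_words n -> omega_words n) :
  (forall x : omega_words n, exists (i : nat) (s : seq 'I_n), (0 < size s)%N /\
     forall z : omega_words n, u (prepend (mkseq x i.+1) z) = prepend s z) ->
  prefix_replacing u.
Proof.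
move=> uP x; have [i [s [s0 us]]] := uP x.
have ss : size s == (size s).-1.+1 by rewrite prednK.
by exists i, (size s).-1, (Tuple ss).
Qed.

Lemma thompsonV_pred1 : 1 \in @thompsonV_pred n.
Proof.
apply/asboolP/prefix_replacingI => x.
by exists 0%N, (mkseq x 1); rewrite size_mkseq.
Qed.

Lemma thompsonV_predV f : f \in @thompsonV_pred n -> f^-1 \in @thompsonV_pred n.
Proof.
move=> /asboolP fV; apply/asboolP/prefix_replacingI => y.
have [i [j [w fw]]] := fV (homeo_inv f y).
have yE : y = prepend w (fun k => homeo_inv f y (i.+1 + k)%N).
  by rewrite -fw prepend_prefix homeo_invK.
exists j, (mkseq (homeo_inv f y) i.+1); rewrite size_mkseq; split=> // z.
have -> : mkseq y j.+1 = w.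
  have := mkseq_prepend w (fun k => homeo_inv f y (i.+1 + k)%N) 0.
  by rewrite -yE size_tuple addn0 cats0.
by rewrite -fw; exact: homeo_funK.
Qed.

Lemma thompsonV_predM f g :
  f \in @thompsonV_pred n -> g \in @thompsonV_pred n ->
  f * g \in @thompsonV_pred n.
Proof.
move=> /asboolP fV /asboolP gV; apply/asboolP/prefix_replacingI => x.
have [i [j [w gw]]] := gV x.
have [i' [j' [w' fw']]] := fV (g x).
pose x' := fun k => x (i.+1 + k)%N.
have yE : g x = prepend w x' by rewrite -gw prepend_prefix.
pose y' := fun k => g x (i'.+1 + k)%N.
exists (i.+1 + i')%N, (w' ++ mkseq y' (size w)).
rewrite size_cat size_tuple; split=> // z.
rewrite -addnS mkseq_add homeo_mulE [in LHS]prepend_cat gw -[in LHS]prepend_cat.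
rewrite -mkseq_prepend -yE addnC mkseq_add prepend_cat fw'.
by rewrite prepend_cat.
Qed.

Lemma thompsonV_closed : group_closed (@thompsonV_pred n).
Proof.
split; first exact: thompsonV_pred1.
by move=> f g fV gV; apply: thompsonV_predM => //; exact: thompsonV_predV.
Qed.

Record thompsonV : Type := ThompsonV {
  thompsonV_val :> homeo (omega_words n);
  thompsonV_valP : thompsonV_val \in @thompsonV_pred n
}.

HB.instance Definition _ := [isSub for thompsonV_val].
HB.instance Definition _ := [Choice of thompsonV by <:].
HB.instance Definition _ :=
  SubChoice_isSubGroup.Build _ _ thompsonV thompsonV_closed.

End ThompsonGroup.

(* Main.v *)
Require Import Defs.
From mathcomp Require Import all_boot all_algebra finmap.
From mathcomp Require Import all_classical topology cantor.

Set Implicit Arguments.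
Unset Strict Implicit.
Unset Printing Implicit Defensive.

Local Open Scope classical_set_scope.
Local Open Scope group_scope.

(** An open set of the group Zariski topology is a union of solution sets of
    finite systems of inequations [w x <> 1], where [w] is a word in [x] with
    constants from the group.  Irreducibility therefore says that finitely many
    such inequations, each of which has a solution, have a common solution.

    This holds in a group [G] acting on a set [T] as soon as the action is
    highly transitive and every nontrivial element moves infinitely many
    points.  An inequation can be put in reduced form, with no subword [x x^-1]
    or [x^-1 x] left.  If no [x] remains, then every [x] solves it.  Otherwise
    choose a starting point [p] and follow it through the letters of the
    reduced word, from right to left, deciding at each occurrence of [x^+-1]
    that [x^+-1] sends the current point to a brand new one.  Reducedness and
    the infinite supports of the constants ensure that the next point at which
    [x^+-1] is to be evaluated has not been assigned a value before, and that
    the final point differs from [p].  So a finite partial injection of [T]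
    already forces the inequation ([free_trajectory], [force_inequation]).
    Treating the inequations one after the other extends a single finite
    partial injection, which some element of [G] realizes
    ([highly_transitive], [inequations_solvable]).

    The homeomorphism group of the space of sequences over a discrete alphabet
    acts in this way on all sequences, and [V_n] on the sequences that are
    eventually equal to a fixed letter.  In both cases high transitivity comes
    from one family of involutions: on two small cylinders, around [p] and
    around [q], swap the letters [p k] and [q k] at every position [k]
    ([cylinder_swap]).  It exchanges [p] and [q], and it is a prefix replacement
    when [p] and [q] have the same tail.  Supports are infinite because a
    nontrivial homeomorphism moves every point of some cylinder.

    Finally, an irreducible space with two points is not Hausdorff, and the
    group Zariski topology separates every element from the identity, so that
    it would be Hausdorff if it were a group topology. *)

(** * Irreducibility and the group Zariski topology *)

Lemma irreducible_nbhs_meet (X : topologicalType) (p q : X) (A B : set X) :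
  irreducible_space X -> nbhs p A -> nbhs q B -> A `&` B !=set0.
Proof.
move=> irrX pA qB; apply: contrapT => AB0.
have proper_compl (r : X) (C : set X) : nbhs r C -> ~` C° `<` setT.
  by move=> rC; split=> // sub; exact: (sub r I).
apply: (irrX _ _ _ _ (proper_compl _ _ pA) (proper_compl _ _ qB)).
- exact/open_closedC/open_interior.
- exact/open_closedC/open_interior.
rewrite -setCI -setC0; congr (~` _).
apply/seteqP; split=> // x [/interior_subset Ax /interior_subset Bx].
by apply: AB0; exists x.
Qed.

Section ZariskiTopology.
Context (G : groupType).

Lemma zariski_open (U : set G) :
  zariski_subbasis U -> open (U : set (zariski G)).
Proof.
move=> subU; exists [set U]; first by move=> _ ->; exact: finI_from1.
by rewrite bigcup_set1.
Qed.

(** A nonempty open set contains a nonempty finite intersection of subbasic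
    sets, each of which is then nonempty; concatenating two such finite families
    gives a point in the intersection of two nonempty open sets. *)
Lemma zariski_irreducible :
  (forall Us : seq (set G),
    (forall U, U \in Us -> zariski_subbasis U /\ U !=set0) ->
    exists x, forall U, U \in Us -> U x) ->
  irreducible_space (zariski G).
Proof.
move=> meetP.
have shrink (U : set (zariski G)) : open U -> U !=set0 ->
    exists Us : seq (set G),
      (forall V, V \in Us -> zariski_subbasis V /\ V !=set0) /\
      (forall x : G, (forall V, V \in Us -> V x) -> U x).
  move=> [B Bsub <-] [x [_ /[dup] /Bsub[D Dsub <-] BV Vx]].
  exists (enum_fset D); split.
    by move=> V VD; split; [have /set_mem := Dsub _ VD | exists x; exact: Vx].
  by move=> y yD; exists (\bigcap_(V in [set` D]) V).
move=> K1 K2 cK1 cK2 pK1 pK2 K12.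
have compl0 (K : set (zariski G)) : K `<` setT -> ~` K !=set0.
  move=> [_ K1T]; apply/set0P/eqP => K0; apply: K1T.
  by rewrite -[K]setCK K0 setC0.
have [Us1 [Us1P sub1]] := shrink _ (closed_openC cK1) (compl0 _ pK1).
have [Us2 [Us2P sub2]] := shrink _ (closed_openC cK2) (compl0 _ pK2).
have [V|x xU] := meetP (Us1 ++ Us2).
  by rewrite mem_cat => /orP[]; [exact: Us1P | exact: Us2P].
have : (K1 `|` K2) x by rewrite K12.
case; [apply: sub1 | apply: sub2] => V VU; apply: xU; rewrite mem_cat VU //.
by rewrite orbT.
Qed.

Lemma irreducible_not_hausdorff (g : G) : g != 1 ->
  irreducible_space (zariski G) -> ~ hausdorff_space (zariski G).
Proof.
move=> /eqP g1 irrG haus; apply: g1.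
apply: (haus (g : zariski G) (1 : zariski G)) => A B.
exact: irreducible_nbhs_meet.
Qed.

(** Were the operations continuous, the preimage of the open set of nontrivial
    elements under [(x, y) |-> x^-1 * y] would contain a product of
    neighbourhoods of [g] and [1]; these meet by irreducibility, which puts
    [x^-1 * x] among the nontrivial elements. *)
Lemma irreducible_not_group_topology (g : G) : g != 1 ->
  irreducible_space (zariski G) -> ~ is_group_topology (zariski G).
Proof.
move=> g1 irrG [contM contV].
pose U : set (zariski G) := [set x | 1 <> x].
have oU : open U.
  apply: zariski_open; exists 1%N, (fun=> 1), (fun=> Posz 1).
  apply/seteqP; split=> x /=;
    by rewrite /word_value big_ord_recl big_ord0 /= !mulg1 mul1g.
have gU : nbhs ((g : zariski G)^-1 * 1) U.
  apply: open_nbhs_nbhs; split=> //; rewrite /U /= mulg1 => /esym/eqP.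
  by rewrite invg_eq1 (negPf g1).
have [[A B] /= [nA nB] AB] := contM ((g : zariski G)^-1, 1 : zariski G) U gU.
have nVA : nbhs (g : zariski G) ((fun x => x^-1) @^-1` A) by exact: contV.
have [x [Ax Bx]] := irreducible_nbhs_meet irrG nVA nB.
by have := AB (x^-1, x) (conj Ax Bx); rewrite /U /= mulVg.
Qed.

End ZariskiTopology.

(** * Inequations over highly transitive groups *)

Section Inequations.
Context (G : groupType).
Implicit Types (c g x : G) (s : seq (bool * G)) (f : G -> G).

Definition signed_power (b : bool) x := if b then x else x^-1.

(** The word [x^e1 g1 x^e2 g2 ...] is stored as the list of the pairs
    (sign, constant that follows). *)
Definition letters_value x s :=
  foldr (fun u y => signed_power u.1 x * (u.2 * y)) 1 s.

(** The constant between the signed powers is [u.2]: nothing cancels unless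
    it is trivial and the signs are opposite. *)
Definition no_cancellation (u v : bool * G) := (u.1 == v.1) || (u.2 != 1).

Definition has_reduced_form f := exists c s,
  sorted no_cancellation s /\ forall x, f x = c * letters_value x s.

Lemma eq_reduced_form f f' :
  f =1 f' -> has_reduced_form f -> has_reduced_form f'.
Proof.
by move=> ff' [c [s [red fE]]]; exists c, s; split=> // x; rewrite -ff'.
Qed.

Lemma reduced_form_cst c : has_reduced_form (fun=> c).
Proof. by exists c, [::]; split=> // x; rewrite mulg1. Qed.

Lemma reduced_form_mull g f :
  has_reduced_form f -> has_reduced_form (fun x => g * f x).
Proof.
by move=> [c [s [red fE]]]; exists (g * c), s; split=> // x; rewrite fE mulgA.
Qed.

(** Either the new letter can be put in front of the reduced word, or it cancels
    the first letter, and what is left is a shorter reduced word preceded by a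
    constant. *)
Lemma reduced_form_letter b f :
  has_reduced_form f -> has_reduced_form (fun x => signed_power b x * f x).
Proof.
move=> [c [[|[b' g] s] [red fE]]].
  by exists 1, [:: (b, c)]; split=> // x; rewrite fE mul1g.
have [nc|] := boolP (no_cancellation (b, c) (b', g)).
  exists 1, [:: (b, c), (b', g) & s]; split; first by rewrite /= nc.
  by move=> x; rewrite fE mul1g.
rewrite negb_or negbK /= => /andP[bb' /eqP c1].
exists g, s; split; first exact: path_sorted red.
move=> x; rewrite fE c1 mul1g /= mulgA.
suff -> : signed_power b x * signed_power b' x = 1 by rewrite mul1g.
by case: b b' bb' {red fE} => [] [] //= _; rewrite ?mulgV ?mulVg.
Qed.

Lemma reduced_form_expgz (k : int) f :
  has_reduced_form f -> has_reduced_form (fun x => expgz x k * f x).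
Proof.
have pow b m : has_reduced_form f ->
    has_reduced_form (fun x => signed_power b x ^+ m * f x).
  move=> red; elim: m => [|m IHm]; first exact: (reduced_form_mull 1 red).
  apply: (eq_reduced_form _ (reduced_form_letter b IHm)) => x.
  by rewrite expgS mulgA.
case: k => m red; first exact: (pow true).
by apply: (eq_reduced_form _ (pow false m.+1 red)) => x; rewrite /= expVgn.
Qed.

Lemma reduced_form_word_value l (g : nat -> G) (k : nat -> int) :
  has_reduced_form (word_value l g k).
Proof.
elim: l g k => [|l IHl] g k.
  apply: (eq_reduced_form _ (reduced_form_cst (g 0%N))) => x.
  by rewrite /word_value big_ord0 mulg1.
have tail := IHl (fun i => g i.+1) (fun i => k i.+1).
apply: (eq_reduced_form _
  (reduced_form_mull (g 0%N) (reduced_form_expgz (k 0%N) tail))) => x.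
by rewrite /word_value big_ord_recl -mulgA.
Qed.

Context (T : eqType) (act : G -> T -> T).
Context (actM : forall g h p, act (g * h) p = act g (act h p))
  (act1 : forall p, act 1 p = p)
  (* by induction, this gives transitivity on n-tuples for every n *)
  (move_one : forall (F : seq T) p q, p \notin F -> q \notin F ->
     exists2 h, act h p = q & {in F, forall r, act h r = r})
  (moved_infinite : forall (F : seq T) g,
     exists2 p, p \notin F & g != 1 -> act g p != p).
Implicit Types (L : seq (T * T)) (p q : T).

Definition partial_injection L := uniq (unzip1 L) && uniq (unzip2 L).

Definition extends x L := forall u, u \in L -> act x u.1 = u.2.

Definition points L := unzip1 L ++ unzip2 L.

(** The points where [x] (for [b = true]) or [x^-1] (for [b = false]) already
    has a prescribed value. *)
Definition source (b : bool) L := if b then unzip1 L else unzip2 L.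

Definition arrow (b : bool) p q := if b then (p, q) else (q, p).

Lemma act_inj g : injective (act g).
Proof. by move=> p q /(congr1 (act g^-1)); rewrite -!actM mulVg !act1. Qed.

Lemma source_points b L : {subset source b L <= points L}.
Proof. by case: b => p pL; rewrite mem_cat pL ?orbT. Qed.

Lemma act_arrow x b p q L :
  extends x (arrow b p q :: L) -> act (signed_power b x) p = q.
Proof.
move=> /(_ (arrow b p q)); rewrite mem_head => /(_ isT).
by case: b => //= <-; rewrite -actM mulVg act1.
Qed.

Lemma partial_injection_arrow b p q L : partial_injection L ->
  p \notin source b L -> q \notin points L ->
  partial_injection (arrow b p q :: L).
Proof.
rewrite /partial_injection mem_cat negb_or => /andP[u1 u2] pL /andP[q1 q2].
by case: b pL => /= pL; rewrite u1 u2 ?pL ?q1 ?q2.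
Qed.

Lemma source_arrow b b' p q L : source b (arrow b' p q :: L) =
  (if b == b' then p else q) :: source b L.
Proof. by case: b b' => [] []. Qed.

(** The points that [c] sends into [F] form the finite set [c^-1 F], which can
    be avoided together with [F]. *)
Lemma fresh_point (F : seq T) c : exists q,
  [/\ q \notin F, act c q \notin F & c != 1 -> act c q != q].
Proof.
have [q] := moved_infinite (F ++ map (act c^-1) F) c.
rewrite mem_cat negb_or => /andP[qF qcF] qc; exists q; split=> //.
by apply: contra qcF => /(map_f (act c^-1)); rewrite -actM mulVg act1.
Qed.

(** An element that already realizes all the pairs but one is corrected by an
    element that fixes the images already reached. *)
Lemma highly_transitive L : partial_injection L -> exists x, extends x L.
Proof.
elim: L => [|[p q] L IHL]; first by exists 1.
rewrite /partial_injection /= -andbA => /and4P[p1 u1 q2 u2].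
have [|x xL] := IHL; first exact/andP.
have [||h hp hL] := @move_one (unzip2 L) (act x p) q => //.
  apply: contra p1 => /mapP[u uL]; rewrite -(xL u uL) => /act_inj ->.
  exact: map_f.
exists (h * x) => u; rewrite inE => /predU1P[->|uL]; rewrite actM //=.
by rewrite xL // hL //; exact: map_f.
Qed.

(** The induction runs from the innermost letter outwards.  The pair [(b, c)]
    stands for what will be applied next, the constant [c] and then a power of
    [x] of sign [b]; the conclusion [act c q \notin source b L'] is what leaves
    the value of that power free to be chosen.  When [c] is trivial, reducedness
    makes two consecutive signs equal, so the new point [q] is in the range of
    [x^+-1], but not in its domain; otherwise [c] moves [q] away from it. *)
Lemma free_trajectory (b : bool) c s L :
  path no_cancellation (b, c) s -> partial_injection L ->
  exists p q L',
    [/\ partial_injection L', {subset L <= L'},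
        forall x, extends x L' -> act (letters_value x s) p = q,
        act c q \notin source b L' & s != [::] -> act c q != p].
Proof.
elim: s b c L => [|[b' g] s IHs] b c L.
  move=> _ injL; have [p [_ cpL _]] := fresh_point (points L) c.
  exists p, p, L; split=> //.
  by apply: contraNN cpL => cps; exact: source_points cps.
rewrite [path _ _ _]/= => /andP[nc red] injL.
have [p [q [L' [injL' subL' trajq gqL' _]]]] := IHs _ _ _ red injL.
have [r [rF crF crr]] := fresh_point (p :: act g q :: points L') c.
move: rF crF; rewrite !inE !negb_or => /and3P[_ _ rL'] /and3P[crp crgq crL'].
exists p, r, (arrow b' (act g q) r :: L'); split=> //.
- exact: partial_injection_arrow.
- by move=> u /subL' uL'; rewrite inE uL' orbT.
- move=> x xL; rewrite /= !actM trajq; last first.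
    by move=> u uL'; apply: xL; rewrite inE uL' orbT.
  exact: act_arrow xL.
rewrite source_arrow inE negb_or; apply/andP; split; last first.
  by apply: contra crL'; exact: source_points.
by move: nc; rewrite /no_cancellation /=; case: eqP.
Qed.

Lemma force_inequation f a L : has_reduced_form f -> 1 <> f a ->
  partial_injection L -> exists L',
    [/\ partial_injection L', {subset L <= L'} &
        forall x, extends x L' -> 1 <> f x].
Proof.
move=> [c [s [red fE]]] fa injL.
case: s => [|[b g] s] in red fE *.
  by exists L; split=> // x _; move: fa; rewrite !fE.
(* No power of [x] follows [c]: any sign that keeps the word reduced will do. *)
have red' : path no_cancellation (b, c) ((b, g) :: s).
  by rewrite /= /no_cancellation eqxx.
have [p [q [L' [injL' subL' traj _ /(_ isT)/eqP cqp]]]] :=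
  free_trajectory red' injL.
exists L'; split=> // x /traj xp; rewrite fE => /(congr1 (act^~ p)).
by rewrite act1 actM xp => /esym.
Qed.

Lemma inequations_solvable (Us : seq (set G)) :
  (forall U, U \in Us -> zariski_subbasis U /\ U !=set0) ->
  exists x, forall U, U \in Us -> U x.
Proof.
move=> Us_ne.
have [L [injL LU]] : exists L, partial_injection L /\
    forall x, extends x L -> forall U, U \in Us -> U x.
  elim: Us Us_ne => [|U Us IHUs] Us_ne; first by exists [::].
  have [V VUs|L [injL LUs]] := IHUs.
    by apply: Us_ne; rewrite inE VUs orbT.
  have [|[l [g [k UE]]] [a Ua]] := Us_ne U; first exact: mem_head.
  rewrite UE in Ua.
  have [L' [injL' sub L'U]] :=
    force_inequation (reduced_form_word_value l g k) Ua injL.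
  exists L'; split=> // x xL' V; rewrite inE => /predU1P[->|]; last first.
    by apply: LUs => u /sub; exact: xL'.
  by rewrite UE; exact: L'U.
by have [x /LU xU] := highly_transitive injL; exists x.
Qed.

Lemma nontrivial_group : exists g : G, g != 1.
Proof.
have [p _ _] := moved_infinite [::] 1.
have [q qp _] := moved_infinite [:: p] 1.
have [//|//|g gp _] := @move_one [::] p q.
by exists g; apply: contraNneq qp => g1; rewrite -gp g1 act1 mem_head.
Qed.

Lemma highly_transitive_zariski :
  [/\ irreducible_space (zariski G), ~ hausdorff_space (zariski G) &
      ~ is_group_topology (zariski G)].
Proof.
have irrG := zariski_irreducible inequations_solvable.
have [g g1] := nontrivial_group.
split=> //; first exact: irreducible_not_hausdorff g1 irrG.
exact: irreducible_not_group_topology g1 irrG.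
Qed.

End Inequations.

(** * Homeomorphisms of sequence spaces *)

Section SequenceSpace.
Context (A : discreteTopologicalType).

Definition sequences : topologicalType := prod_topology (fun _ : nat => A).
Implicit Types (x y : sequences) (U : set sequences).

Definition agree (m : nat) x y := forall k, (k < m)%N -> y k = x k.

Lemma nbhs_coordinate x k : nbhs x [set y : sequences | y k = x k].
Proof.
exact: (@proj_continuous nat (fun=> A) k x _ (discrete_set1 (x k))).
Qed.

Lemma nbhs_agree x m : nbhs x (agree m x).
Proof.
elim: m => [|m IHm]; first by apply: filterS filterT => y _ k.
apply: filterS (filterI IHm (nbhs_coordinate x m)) => y [yx yxm] k.
by rewrite ltnS leq_eqVlt => /predU1P[->|/yx].
Qed.

Definition agree_filter x : set_system sequences :=
  [set U | exists m, agree m x `<=` U].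

Lemma agree_filter_filter x : Filter (agree_filter x).
Proof.
split.
- by exists 0%N.
- move=> U V [m mU] [m' m'V]; exists (maxn m m') => y yx; split.
    by apply: mU => k km; apply: yx; rewrite leq_max km.
  by apply: m'V => k km; apply: yx; rewrite leq_max km orbT.
- by move=> U V UV [m mU]; exists m => y /mU/UV.
Qed.

(** The cylinders around [x] generate a filter that converges to [x] coordinate
    by coordinate, hence for the product topology. *)
Lemma nbhs_agree_sub x U : nbhs x U -> exists m, agree m x `<=` U.
Proof.
suff : agree_filter x --> x by exact.
have F := agree_filter_filter x.
apply/cvg_sup => k V [_ [[B _ <-] Bx] BV]; exists k.+1 => y yx; apply: BV.
by rewrite /= yx.
Qed.

Lemma continuous_agreeP (f : sequences -> sequences) : continuous f <->
  forall x k, exists m, forall y, agree m x y -> f y k = f x k.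
Proof.
split=> [cf x k|fP x].
  have fk : nbhs x [set y | f y k = f x k] := cf x _ (nbhs_coordinate (f x) k).
  by have [m mf] := nbhs_agree_sub fk; exists m.
have F : Filter (f @ x) by exact: (fmap_filter _ (nbhs_filter x)).
apply/cvg_sup => k V [_ [[B _ <-] Bfx] BV].
have [m mf] := fP x k.
by apply: filterS (nbhs_agree x m) => y /mf fy; apply: BV; rewrite /= fy.
Qed.

Lemma agree_refl m x : agree m x x. Proof. by []. Qed.

Lemma agree_sym m x y : agree m x y -> agree m y x.
Proof. by move=> xy k /xy. Qed.

Lemma agree_trans m x y z : agree m x y -> agree m y z -> agree m x z.
Proof. by move=> xy yz k km; rewrite yz // xy. Qed.

Lemma agree_leq m m' x y : (m <= m')%N -> agree m' x y -> agree m x y.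
Proof. by move=> mm' xy k /leq_trans/(_ mm')/xy. Qed.

Lemma separating_prefix (F : seq sequences) x : x \notin F ->
  exists m, forall y, y \in F -> ~ agree m x y.
Proof.
elim: F => [|z F IHF]; first by exists 0%N.
rewrite inE negb_or => /andP[/eqP xz /IHF[m mF]].
have [k zk] : exists k, z k <> x k.
  by apply/existsNP => zx; apply: xz; apply/funext => k; rewrite zx.
exists (maxn m k.+1) => y; rewrite inE => /predU1P[-> zx|/mF yx].
  by apply: zk; apply: zx; rewrite leq_max ltnSn orbT.
by apply: contra_not yx; apply: agree_leq; exact: leq_maxl.
Qed.

Definition letter_swap (a b c : A) :=
  if c == a then b else if c == b then a else c.

Lemma letter_swapl a b : letter_swap a b a = b.
Proof. by rewrite /letter_swap eqxx. Qed.

Lemma letter_swapr a b : letter_swap a b b = a.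
Proof. by rewrite /letter_swap eqxx; case: eqP. Qed.

Lemma letter_swapxx a : letter_swap a a =1 id.
Proof. by move=> c; rewrite /letter_swap; case: eqP. Qed.

Lemma letter_swapK a b : involutive (letter_swap a b).
Proof.
move=> c; rewrite {2}/letter_swap.
have [->|ca] := eqVneq c a; first exact: letter_swapr.
have [->|cb] := eqVneq c b; first exact: letter_swapl.
by rewrite /letter_swap (negPf ca) (negPf cb).
Qed.

Section CylinderSwap.
Context (p q : sequences) (m : nat).

(** The letterwise swap of [p] and [q], restricted to the cylinders of length
    [m] around them; it exchanges these two cylinders, hence is an involution. *)
Definition cylinder_swap x : sequences :=
  if `[< agree m p x \/ agree m q x >]
  then fun k => letter_swap (p k) (q k) (x k) else x.

Lemma cylinder_swap_outside x :
  ~ agree m p x -> ~ agree m q x -> cylinder_swap x = x.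
Proof. by move=> px qx; rewrite /cylinder_swap asboolF // => -[]. Qed.

Lemma cylinder_swap_inside x k : agree m p x \/ agree m q x ->
  cylinder_swap x k = letter_swap (p k) (q k) (x k).
Proof. by move=> pqx; rewrite /cylinder_swap asboolT. Qed.

Lemma cylinder_swapl : cylinder_swap p = q.
Proof.
apply/funext => k; rewrite cylinder_swap_inside ?letter_swapl //.
by left; exact: agree_refl.
Qed.

Lemma cylinder_swapK : involutive cylinder_swap.
Proof.
move=> x; have [xpq|xpq] := pselect (agree m p x \/ agree m q x); last first.
  by rewrite !cylinder_swap_outside // => ?; apply: xpq; by [left|right].
apply/funext => k; rewrite cylinder_swap_inside; last first.
  case: (xpq) => xs; [right|left] => j jm; rewrite cylinder_swap_inside //.
    by rewrite xs // letter_swapl.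
  by rewrite xs // letter_swapr.
by rewrite cylinder_swap_inside // letter_swapK.
Qed.

Lemma cylinder_swap_agree m' x y : (m <= m')%N ->
  agree m' x y -> agree m' (cylinder_swap x) (cylinder_swap y).
Proof.
move=> mm' xy k km'; have {}mxy := agree_leq mm' xy.
have [xpq|xpq] := pselect (agree m p x \/ agree m q x).
  rewrite !cylinder_swap_inside ?xy //.
  by case: xpq => xs; [left|right]; exact: agree_trans xs mxy.
have [xp xq] : ~ agree m p x /\ ~ agree m q x.
  by split=> xs; apply: xpq; [left|right].
have agree_yx r : agree m r y -> agree m r x.
  by move=> ry; exact: agree_trans ry (agree_sym mxy).
rewrite (cylinder_swap_outside xp xq) cylinder_swap_outside ?xy //.
- by move=> /(@agree_yx p).
- by move=> /(@agree_yx q).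
Qed.

Lemma cylinder_swap_continuous : continuous cylinder_swap.
Proof.
apply/continuous_agreeP => x k; exists (maxn m k.+1) => y.
move=> /(cylinder_swap_agree (leq_maxl _ _)); apply.
by rewrite leq_max ltnSn orbT.
Qed.

Definition cylinder_swap_homeo : homeo sequences :=
  Homeo cylinder_swapK cylinder_swapK
        cylinder_swap_continuous cylinder_swap_continuous.

End CylinderSwap.

(** Long prefixes of [p] and [q] separate them from the finitely many points of
    [F], which then lie outside the two cylinders.  The bound [m0] makes room
    for the prefixes after which [p] and [q] have the same tail. *)
Lemma move_one_sequence (F : seq sequences) p q m0 : p \notin F -> q \notin F ->
  exists2 m, (m0 <= m)%N & cylinder_swap_homeo p q m p = q /\
    {in F, forall r, cylinder_swap_homeo p q m r = r}.
Proof.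
move=> /separating_prefix[m1 pF] /separating_prefix[m2 qF].
exists (maxn m0 (maxn m1 m2)); first exact: leq_maxl.
split=> [|r rF]; first exact: cylinder_swapl.
apply: cylinder_swap_outside => sr.
  by apply: (pF _ rF); apply: agree_leq sr; rewrite !leq_max leqnn orbT.
by apply: (qF _ rF); apply: agree_leq sr; rewrite !leq_max leqnn !orbT.
Qed.

Context (a0 a1 : A) (a01 : a0 != a1).

Definition eventually_const (a : A) x :=
  exists m, forall k, (m <= k)%N -> x k = a.

(** A cylinder contains infinitely many eventually constant points, for
    instance those that have, past the prefix, the letter [a1] at one arbitrary
    position and [a0] everywhere else. *)
Lemma infinite_cylinder (F : seq sequences) p m :
  exists q, [/\ q \notin F, agree m p q & eventually_const a0 q].
Proof.
pose spike j : sequences := fun k =>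
  if (k < m)%N then p k else if k == (m + j)%N then a1 else a0.
have spike_inj : injective spike.
  move=> i j /(congr1 (fun x : sequences => x (m + i)%N)) /eqP.
  rewrite /spike ltnNge leq_addr /= eqxx eqn_add2l.
  by case: (i =P j) => // _; rewrite eq_sym (negPf a01).
have [j jF] : exists j, spike j \notin F.
  apply: contrapT => /forallNP allF.
  suff : ((size F).+1 <= size F)%N by rewrite ltnn.
  rewrite -[leqLHS](size_iota 0) -(size_map spike).
  apply: uniq_leq_size; first by rewrite map_inj_uniq ?iota_uniq.
  by move=> _ /mapP[j _ ->]; apply: contrapT => jF; apply: (allF j); apply/negP.
exists (spike j); split=> // [k km|]; first by rewrite /spike km.
exists (m + j).+1 => k mjk; rewrite /spike.
by rewrite ltnNge (leq_trans (leq_addr j m)) ?(ltnW mjk) // gtn_eqF.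
Qed.

(** If [g p] and [p] differ at position [k], then [g y] and [y] also differ at
    [k] for all [y] sharing a long enough prefix with [p]. *)
Lemma moved_sequence (F : seq sequences) (g : homeo sequences) :
  exists q, [/\ q \notin F, eventually_const a0 q & g <> 1 -> g q <> q].
Proof.
have [p [m pm]] : exists p m, g <> 1 -> forall y, agree m p y -> g y <> y.
  have [->|g1] := pselect (g = 1); first by exists (fun=> a0), 0%N.
  have [p gp] : exists p, g p <> p.
    by apply/existsNP => gid; apply: g1; apply/homeo_inj/funext.
  have [k gpk] : exists k, g p k <> p k.
    by apply/existsNP => gid; apply: gp; exact/funext.
  have /continuous_agreeP/(_ p k)[m mg] := @homeo_fun_continuous _ g.
  exists p, (maxn m k.+1) => _ y py gy; apply: gpk.
  rewrite -(mg y); last by apply: agree_leq py; exact: leq_maxl.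
  by rewrite gy py // leq_max ltnSn orbT.
have [q [qF pq q0]] := infinite_cylinder F p m.
by exists q; split=> // /pm; exact.
Qed.

End SequenceSpace.

Lemma homeo_sequences_zariski (A : discreteTopologicalType) (a0 a1 : A) :
  a0 != a1 ->
  [/\ irreducible_space (zariski (homeo (sequences A))),
      ~ hausdorff_space (zariski (homeo (sequences A))) &
      ~ is_group_topology (zariski (homeo (sequences A)))].
Proof.
move=> a01.
apply: (@highly_transitive_zariski _ (sequences A)
  (@homeo_fun (sequences A))) => //.
  move=> F p q pF qF; have [m _ [pq fixF]] := move_one_sequence 0 pF qF.
  by exists (cylinder_swap_homeo p q m).
move=> F g; have [p [pF _ gp]] := moved_sequence a01 F g.
by exists p => // /eqP/gp/eqP.
Qed.

(** * Thompson's groups V_n *)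

Section ThompsonV.
Context (n : nat) (a0 a1 : 'I_n) (a01 : a0 != a1).

Definition eventually_const_words :=
  {x : omega_words n | `[< eventually_const (a0 : discrete_topology 'I_n) x >]}.

Lemma thompsonV_eventually_const (g : thompsonV n) (x : omega_words n) :
  eventually_const (a0 : discrete_topology 'I_n) x ->
  eventually_const (a0 : discrete_topology 'I_n) (g x).
Proof.
move=> [m x0]; have /asboolP/(_ x)[i [j [y gy]]] := thompsonV_valP g.
have -> : g x = prepend y (fun k => x (i.+1 + k)%N).
  by rewrite -gy prepend_prefix.
exists (j.+1 + m)%N => k jmk; rewrite /prepend size_tuple.
have jk : (j < k)%N by apply: leq_trans jmk; rewrite addSn ltnS leq_addr.
rewrite nth_default ?size_tuple // x0 //.
by apply: leq_trans (leq_addl _ _); rewrite leq_subRL.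
Qed.

(** From position [m] on the swapped letters coincide, so only the first [m]
    letters of a sequence can change; the prefix has length [m.+1] because
    replaced prefixes must be nonempty. *)
Lemma cylinder_swap_prefix_replacing (p q : omega_words n) m :
  (forall k, (m <= k)%N -> p k = q k) ->
  cylinder_swap_homeo (p : sequences (discrete_topology 'I_n)) q m
    \in @thompsonV_pred n.
Proof.
move=> pq; apply/asboolP/prefix_replacingI => x.
set f := homeo_fun _.
exists m, (mkseq (f x) m.+1); rewrite size_mkseq; split=> // z.
have xy : agree m.+1 (x : sequences (discrete_topology 'I_n))
    (prepend (mkseq x m.+1) z).
  by move=> k km; rewrite /prepend nth_mkseq.
apply/funext => k; have [km|mk] := ltnP k m.+1.
  rewrite [RHS]/prepend nth_mkseq //.
  exact: (@cylinder_swap_agree _ p q _ _ _ _ (leqnSn m) xy k km).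
have fk y : f y k = y k.
  rewrite /f /= /cylinder_swap; case: ifP => // _.
  by rewrite pq ?(ltnW mk) // letter_swapxx.
by rewrite fk /prepend !nth_default ?size_mkseq.
Qed.

Definition act_eventually_const (g : thompsonV n) (u : eventually_const_words) :
    eventually_const_words :=
  Sub (g (val u)) (asboolT (thompsonV_eventually_const g (asboolW (valP u)))).

Lemma thompsonV_zariski :
  [/\ irreducible_space (zariski (thompsonV n)),
      ~ hausdorff_space (zariski (thompsonV n)) &
      ~ is_group_topology (zariski (thompsonV n))].
Proof.
apply: (highly_transitive_zariski (act := act_eventually_const)).
- by move=> g h u; exact: val_inj.
- by move=> u; exact: val_inj.
- move=> F u v uF vF.
  have [[m1 u0] [m2 v0]] := (asboolW (valP u), asboolW (valP v)).
  have notin w : w \notin F -> val w \notin map val F.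
    by rewrite mem_map //; exact: val_inj.
  have [m m12 [uv fixF]] :=
    move_one_sequence (maxn m1 m2) (notin _ uF) (notin _ vF).
  have swapV : cylinder_swap_homeo (val u) (val v) m \in @thompsonV_pred n.
    apply: cylinder_swap_prefix_replacing => k mk.
    move: (leq_trans m12 mk); rewrite geq_max => /andP[m1k m2k].
    by rewrite (u0 _ m1k) (v0 _ m2k).
  exists (ThompsonV swapV); first exact: val_inj.
  by move=> r rF; apply: val_inj; apply: fixF; exact: map_f.
- move=> F g; have [q [qF q0 gq]] :=
    moved_sequence (a01 : (a0 : discrete_topology 'I_n) != a1) (map val F) g.
  exists (Sub q (asboolT q0)).
    by apply: contra qF => /(map_f val).
  move=> /eqP g1; apply/eqP => /(congr1 val) /=; apply: gq => gval.
  by apply: g1; exact: val_inj.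
Qed.

End ThompsonV.

Theorem theorem2p3 :
  (forall n : nat, (2 <= n)%N -> irreducible_space (zariski (thompsonV n))) /\
  irreducible_space (zariski (homeo cantor_space)) /\
  (forall n : nat, (2 <= n)%N ->
     ~ hausdorff_space (zariski (thompsonV n)) /\
     ~ is_group_topology (zariski (thompsonV n))) /\
  ~ hausdorff_space (zariski (homeo cantor_space)) /\
  ~ is_group_topology (zariski (homeo cantor_space)).
Proof.
have zarV (n : nat) : (2 <= n)%N ->
    [/\ irreducible_space (zariski (thompsonV n)),
        ~ hausdorff_space (zariski (thompsonV n)) &
        ~ is_group_topology (zariski (thompsonV n))].
  by case: n => [|[|m]] // _; exact: (@thompsonV_zariski _ ord0 ord_max).
have [irrH nhausH ntopH] : [/\ irreducible_space (zariski (homeo cantor_space)),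
    ~ hausdorff_space (zariski (homeo cantor_space)) &
    ~ is_group_topology (zariski (homeo cantor_space))].
  exact: (@homeo_sequences_zariski bool false true).
split; first by move=> n /zarV[].
by split=> //; split=> // n /zarV[].
Qed.
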